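(* Let $E$ be a homogeneous effect algebra. Then $C(E)=C(K(E))=K(E)_S$.
   Context: An effect algebra is a partial algebra $(E;\oplus,0,1)$ with a partial binary operation $\oplus$ and two constants $0,1$ such that: (E1) if $a\oplus b$ is defined, then $b\oplus a$ is defined and $a\oplus b=b\oplus a$; (E2) if $a\oplus b$ and $(a\oplus b)\oplus c$ are defined, then $b\oplus c$ and $a\oplus(b\oplus c)$ are defined and $(a\oplus b)\oplus c=a\oplus(b\oplus c)$; (E3) for every $a\in E$ there is a unique $a'\in E$ with $a\oplus a'=1$; (E4) if $a\oplus 1$ is defined, then $a=0$. Write $a\le b$ iff there is $c\in E$ with $a\oplus c=b$; this is a partial order with least element $0$ and greatest element $1$, and if $a\le b$ then $b\ominus a$ denotes the unique $c$ with $a\oplus c=b$. Write $a\perp b$ iff $a\oplus b$ is defined. A sub-effect algebra of $E$ is a subset $E_0\subseteq E$ with $1\in E_0$ and $a\ominus b\in E_0$ for all $a,b\in E_0$ with $a\ge b$; it is then an effect algebra with the restricted operation. An effect algebra $E$ satisfies the Riesz decomposition property iff for all $u,v_1,\ldots,v_n\in E$ such that $v_1\oplus\cdots\oplus v_n$ exists and $u\le v_1\oplus\cdots\oplus v_n$, there are $u_1,\ldots,u_n\in E$ with $u_i\le v_i$ for all $i$ and $u=u_1\oplus\cdots\oplus u_n$. A block of an effect algebra is a maximal (with respect to inclusion) sub-effect algebra satisfying the Riesz decomposition property. An effect algebra $E$ is homogeneous iff for all $u,v_1,v_2\in E$ such that $v_1\perp v_2$, $u\le v_1\oplus v_2$ and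 $u\le (v_1\oplus v_2)'$, there are $u_1,u_2\in E$ with $u_1\le v_1$, $u_2\le v_2$ and $u=u_1\oplus u_2$. For homogeneous $E$, the compatibility center is $K(E)=\bigcap\{B: B\text{ is a block of }E\}$, a sub-effect algebra of $E$. An element $a$ of an effect algebra $F$ is sharp iff $a\wedge a'=0$ in $F$ (i.e. $0$ is the only element of $F$ below both $a$ and $a'$); $F_S$ is the set of all sharp elements of $F$. An element $a\in F$ is principal iff the interval $[0,a]$ is closed under $\oplus$ (if $x,y\le a$ and $x\perp y$ then $x\oplus y\le a$). A principal element $a$ is central in $F$ iff every $b\in F$ has a unique decomposition $b=b_1\oplus b_2$ with $b_1\le a$, $b_2\le a'$. The center $C(F)$ is the set of all central elements of $F$. These notions are applied to the effect algebras $F=E$ and $F=K(E)$.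
   Formalization: Central elements a are additionally required to have a' principal (the standard definition); with only a principal the claim fails, e.g. in the orthoalgebra with atoms a,p,q,r,P,Q,R and lines apP, aqQ, arR, pqr. *)

(* Defs.v *)
From HB Require Import structures.
From mathcomp Require Import all_boot.
From mathcomp Require Import boolp classical_sets.

Set Implicit Arguments.
Unset Strict Implicit.
Unset Printing Implicit Defensive.

Local Open Scope classical_set_scope.

(* The partial operation is option-valued: [oplus a b = None] means that the
   sum is undefined.  The trivial algebra (0 = 1) is allowed. *)
HB.mixin Record isEffectAlgebra (T : Type) := {
  oplus : T -> T -> option T;
  ezero : T;
  eone : T;
  oplusC : forall a b c : T, oplus a b = Some c -> oplus b a = Some c;
  oplusA : forall a b c ab abc : T,
    oplus a b = Some ab -> oplus ab c = Some abc ->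
    exists2 bc, oplus b c = Some bc & oplus a bc = Some abc;
  ecompl_ex : forall a : T, exists! a' : T, oplus a a' = Some eone;
  oplus_one : forall a b : T, oplus a eone = Some b -> a = ezero
}.

#[short(type="effectAlgebraType")]
HB.structure Definition EffectAlgebra := {T of isEffectAlgebra T}.

Arguments ezero {_}.
Arguments eone {_}.
Arguments oplusC {_} [_ _ _] _.
Arguments oplusA {_} [_ _ _ _ _] _ _.
Arguments oplus_one {_} [_ _] _.

Section Basics.
Variable E : effectAlgebraType.
Implicit Types a b c u v x y z : E.

Definition ecompl a : E := projT1 (cid (ecompl_ex a)).

Definition ele a b : Prop := exists c, oplus a c = Some b.

Definition oplus_opt (s t : option E) : option E :=
  if s is Some a then if t is Some b then oplus a b else None else None.

(* By associativity and commutativity, neither the bracketing nor the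
   trailing zero of the iterated operation matters. *)
Definition osum n (v : 'I_n -> E) : option E :=
  \big[oplus_opt/Some ezero]_(i < n) Some (v i).

Definition riesz_decomposition : Prop :=
  forall (n : nat) (u : E) (v : 'I_n.+1 -> E) (w : E),
    osum v = Some w -> ele u w ->
    exists2 u_ : 'I_n.+1 -> E,
      forall i, ele (u_ i) (v i) & osum u_ = Some u.

Definition homogeneous : Prop :=
  forall u v1 v2 w : E,
    oplus v1 v2 = Some w -> ele u w -> ele u (ecompl w) ->
    exists u1 u2 : E, [/\ ele u1 v1, ele u2 v2 & oplus u1 u2 = Some u].

Definition sharp_element a : Prop :=
  forall x, ele x a -> ele x (ecompl a) -> x = ezero.

Definition sharp_set : set E := [set a | sharp_element a].

Definition principal a : Prop :=
  forall x y z, ele x a -> ele y a -> oplus x y = Some z -> ele z a.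

(* As in Greechie, Foulis and Pulmannova, both [a] and its orthosupplement are
   required to be principal.  Without the condition on [ecompl a] the
   decompositions need not make E the direct product of [0, a] and [0, a']: in
   the orthoalgebra with atoms a, p, q, r, P, Q, R and blocks {a,p,P}, {a,q,Q},
   {a,r,R}, {p,q,r}, the element a is principal and every element has a unique
   decomposition along a, but p, q <= a' while (p + q) is not below a'. *)
Definition central a : Prop :=
  [/\ principal a, principal (ecompl a) &
      forall b, exists! d : E * E,
        [/\ ele d.1 a, ele d.2 (ecompl a) & oplus d.1 d.2 = Some b]].

Definition center : set E := [set a | central a].

Lemma oplus10 : oplus (eone : E) ezero = Some eone.
Proof.
have [x [x1 _]] := ecompl_ex (eone : E).
by rewrite -(oplus_one (oplusC x1)).
Qed.

(* Closure under differences: [oplus b c = Some a] says that b <= a and that c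
   is the difference of a and b. *)
Definition sub_effect_algebra (S : set E) : Prop :=
  S eone /\ forall a b c, S a -> S b -> oplus b c = Some a -> S c.

Record subEffectAlgebra := SubEffectAlgebra {
  subea_set :> set E;
  subea_closed : sub_effect_algebra subea_set
}.

End Basics.

Arguments riesz_decomposition : clear implicits.
Arguments homogeneous : clear implicits.
Arguments sharp_set : clear implicits.
Arguments center : clear implicits.
Arguments subEffectAlgebra : clear implicits.

Section SubEffectAlgebra.
Variables (E : effectAlgebraType) (B : subEffectAlgebra E).

Lemma subea_one : subea_set B eone.
Proof. by case: (subea_closed B). Qed.

Lemma subea_diff (a b c : E) : subea_set B a -> subea_set B b -> oplus b c = Some a -> subea_set B c.
Proof. by case: (subea_closed B) => _; apply. Qed.

Lemma subea_zero : subea_set B ezero.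
Proof. exact: subea_diff subea_one subea_one (oplus10 E). Qed.

Lemma subea_compl (a b : E) : subea_set B a -> oplus a b = Some eone -> subea_set B b.
Proof. exact: subea_diff subea_one. Qed.

Lemma subea_oplus (a b c : E) : subea_set B a -> subea_set B b -> oplus a b = Some c -> subea_set B c.
Proof.
move=> Ba Bb abc.
have [c' [cc' _]] := ecompl_ex c.
have [d bd ad] := oplusA abc cc'.
have Bd : subea_set B d := subea_compl Ba ad.
exact: subea_compl (subea_diff Bd Bb bd) (oplusC cc').
Qed.

Definition subea_sort : Type := {x : E | x \in subea_set B}.

Definition subea_val (x : subea_sort) : E := val x.

Definition subea_plus (x y : subea_sort) : option subea_sort :=
  obind insub (oplus (subea_val x) (subea_val y)).

Lemma subea_valP (x : subea_sort) : subea_set B (subea_val x).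
Proof. exact: set_mem (valP x). Qed.

Lemma subea_val_inj : injective subea_val.
Proof. exact: val_inj. Qed.

Lemma subea_plusE (x y : subea_sort) :
  omap subea_val (subea_plus x y) = oplus (subea_val x) (subea_val y).
Proof.
rewrite /subea_plus; case xy: (oplus _ _) => [z|//] /=.
have Bz := mem_set (subea_oplus (subea_valP x) (subea_valP y) xy).
by rewrite insubT.
Qed.

Lemma subea_plusP (x y z : subea_sort) :
  subea_plus x y = Some z <-> oplus (subea_val x) (subea_val y) = Some (subea_val z).
Proof.
rewrite -subea_plusE; split=> [-> //|].
by case: (subea_plus x y) => // t [] /subea_val_inj ->.
Qed.

Definition subea_ezero : subea_sort := exist _ ezero (mem_set subea_zero).

Definition subea_eone : subea_sort := exist _ eone (mem_set subea_one).

Fact subea_plusC (a b c : subea_sort) :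
  subea_plus a b = Some c -> subea_plus b a = Some c.
Proof. by move/subea_plusP/oplusC/subea_plusP. Qed.

Fact subea_plusA (a b c ab abc : subea_sort) :
  subea_plus a b = Some ab -> subea_plus ab c = Some abc ->
  exists2 bc, subea_plus b c = Some bc & subea_plus a bc = Some abc.
Proof.
move=> /subea_plusP h1 /subea_plusP h2; have [d bcd ad] := oplusA h1 h2.
have Bd := mem_set (subea_oplus (subea_valP b) (subea_valP c) bcd).
by exists (exist _ d Bd); apply/subea_plusP.
Qed.

Fact subea_compl_ex (a : subea_sort) :
  exists! a' : subea_sort, subea_plus a a' = Some subea_eone.
Proof.
have [d [ad du]] := ecompl_ex (subea_val a).
exists (exist _ d (mem_set (subea_compl (subea_valP a) ad))).
split=> [|e /subea_plusP /du ed]; first exact/subea_plusP.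
exact: subea_val_inj.
Qed.

Fact subea_plus_one (a b : subea_sort) :
  subea_plus a subea_eone = Some b -> a = subea_ezero.
Proof. by move/subea_plusP/oplus_one => a0; apply: subea_val_inj. Qed.

HB.instance Definition _ := isEffectAlgebra.Build subea_sort
  subea_plusC subea_plusA subea_compl_ex subea_plus_one.

End SubEffectAlgebra.

Section CompatibilityCenter.
Variable E : effectAlgebraType.

Definition block (B : subEffectAlgebra E) : Prop :=
  riesz_decomposition (subea_sort B) /\
  forall C : subEffectAlgebra E,
    riesz_decomposition (subea_sort C) -> B `<=` C -> C `<=` B.

Definition compatibility_center_set : set E :=
  \bigcap_(B in [set B : subEffectAlgebra E | block B]) subea_set B.

Lemma compatibility_center_closed : sub_effect_algebra compatibility_center_set.
Proof.
split=> [B _|a b c Ka Kb bca B bB]; first exact: subea_one.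
exact: subea_diff (Ka B bB) (Kb B bB) bca.
Qed.

Definition compatibility_center : subEffectAlgebra E :=
  SubEffectAlgebra compatibility_center_closed.

End CompatibilityCenter.

Arguments compatibility_center : clear implicits.

(* Main.v *)
Require Import Defs.
From HB Require Import structures.
From mathcomp Require Import all_boot.
From mathcomp Require Import boolp classical_sets.

Set Implicit Arguments.
Unset Strict Implicit.
Unset Printing Implicit Defensive.

Local Open Scope classical_set_scope.

(** Blocks are described by finite partitions of unity.  A word is a finite
    family, and one word refines another when each entry of the second is the
    sum of the entries of the first over a fibre of an index map.  A set of
    words is directed when all its words have sum 1 and any two of them have a
    common refinement in it.  The blocks of a homogeneous effect algebra E turn out to
    be exactly the sets of partial sums ([subsums]) of the words of a maximal
    directed set D ([block_subsums], [subsums_algebra_block]).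

    In one direction, the words with entries in a subalgebra that has the Riesz
    decomposition property are directed ([words_in_directed]), by the usual
    matrix of common parts ([common_refinement1]).  In the other direction, call
    t isotropic below w when t <= w and t <= w'.  Homogeneity splits such a t
    along every decomposition of w ([homogeneous_split_below]), so any two
    refinements that cut each entry into isotropic pieces and one remainder
    have a common refinement of the same kind ([common_isotropic_refinement]).
    Adding all of these to a directed set keeps it directed, so a maximal D
    contains them already ([maximal_isotropic_refinement]).  This is enough to
    represent a partial sum a <= s by a part of the entries that represent s:
    after cancelling the overlap of two arbitrary representations, what is left
    of a is isotropic below what is left of s ([maximal_nested]).  Closure of
    [subsums D] under differences and its Riesz decomposition property follow.

    Consequences for blocks, by enlarging directed sets:
    - two orthogonal elements lie in a common block ([orthogonal_block]);
    - with a, a block contains all t such that t <= a and t <= a'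
      ([block_isotropic]);
    - every block contains every central element z, because cutting all words
      of D along z yields refinements compatible with D ([central_block]).

    Let K be the compatibility center.  A central element z of E lies in K by
    the third fact.  The decomposition along z of an element of K is, by
    uniqueness, the one that each block provides, so z is central in K
    ([central_compatibility_center]).  Central elements are sharp, being
    principal ([principal_sharp]).  Finally, let a be sharp in K.  By the second
    fact a is sharp in E.  Since a lies in every block, the Riesz property of a
    block containing orthogonal x, y <= a shows that a is principal, and that of
    a block containing b decomposes b along a; the same holds for a', and
    uniqueness of the decompositions follows from principality
    ([compatibility_center_central]). *)

Notation "s [+] t" := (oplus_opt s t) (at level 50, left associativity).

(** * Arithmetic of effect algebras *)

Section OptionSum.
Variable E : effectAlgebraType.
Implicit Types (a b c x y z : E) (s t r : option E).

Lemma oplusE a b : oplus a b = Some a [+] Some b.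
Proof. by []. Qed.

Lemma oplus_optC : commutative (@oplus_opt E).
Proof.
move=> [a|] [b|] //=; case ab: (oplus a b) => [c|]; first by rewrite (oplusC ab).
by case ba: (oplus b a) => [c|//]; rewrite (oplusC ba) in ab.
Qed.

(** One implication of associativity between definedness conditions; the
    converse is its mirror image by commutativity. *)
Lemma oplus_optA_half s t r x : s [+] t [+] r = Some x -> s [+] (t [+] r) = Some x.
Proof.
case: s t r => [a|] [b|] [c|] //=; case ab: (oplus a b) => [d|] //= dc.
by have [e -> ] := oplusA ab dc.
Qed.

Lemma oplus_optA : associative (@oplus_opt E).
Proof.
move=> s t r; case h: (s [+] t [+] r) => [x|]; first exact: oplus_optA_half h.
case k: (s [+] (t [+] r)) => [x|//]; move: k.
rewrite oplus_optC (oplus_optC t) => /oplus_optA_half.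
by rewrite oplus_optC (oplus_optC t) h.
Qed.

Lemma ecomplP a : oplus a (ecompl a) = Some eone.
Proof. by rewrite /ecompl; case: cid => x []. Qed.

Lemma ecompl_unique a b : oplus a b = Some eone -> b = ecompl a.
Proof.
have [c [_ cu]] := ecompl_ex a.
by move=> /cu <-; apply: cu; exact: ecomplP.
Qed.

(** Both [s] and [t] complete [a (+) d'] to the unit, where [d = a (+) s]. *)
Lemma oplus_opt_cancel a s t d : Some a [+] s = Some d -> Some a [+] t = Some d -> s = t.
Proof.
case: s t => [b|] [c|] // ab ac.
have key x : Some a [+] Some x = Some d ->
    exists2 e, Some a [+] Some (ecompl d) = Some e & x = ecompl e.
  move=> ax; have := ecomplP d; rewrite oplusE -ax.
  rewrite (oplus_optC (Some a)) -oplus_optA.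
  case ae: (Some a [+] _) => [e|//]; rewrite oplus_optC => xe; exists e => //.
  exact: ecompl_unique.
have [e e1 ->] := key _ ab; have [f f1 ->] := key _ ac.
by move: f1; rewrite e1 => -[->].
Qed.

Lemma oplus_cancel a b c d : oplus a b = Some d -> oplus a c = Some d -> b = c.
Proof. by move=> ab ac; have [] := oplus_opt_cancel (s := Some b) (t := Some c) ab ac. Qed.

Lemma oplus_opt0 : left_id (Some ezero) (@oplus_opt E).
Proof.
have add0 a : Some a [+] Some ezero = Some a.
  (* [a (+) 0] is defined because [a' (+) a (+) 0 = 1 (+) 0 = 1]. *)
  have h := oplus10 E; rewrite oplusE in h.
  move: h; rewrite -(ecomplP a) oplusE.
  rewrite (oplus_optC (Some a)) -oplus_optA => h.
  apply: (@oplus_opt_cancel (ecompl a) _ _ eone); last first.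
    by rewrite oplus_optC; exact: ecomplP.
  by rewrite h oplus_optC; exact: ecomplP.
by move=> [a|//]; rewrite oplus_optC add0.
Qed.

HB.instance Definition _ :=
  Monoid.isComLaw.Build (option E) (Some ezero) (@oplus_opt E)
    oplus_optA oplus_optC oplus_opt0.

Lemma oplus_opt_r0 s : s [+] Some ezero = s.
Proof. by rewrite oplus_optC oplus_opt0. Qed.

Lemma oplus_opt_defl s t x : s [+] t = Some x -> exists y, s = Some y.
Proof. by case: s => [y|//]; exists y. Qed.

Lemma oplus_opt_eq0 a b : Some a [+] Some b = Some ezero -> a = ezero.
Proof.
move=> ab; have /= h := ecomplP ezero.
move: h; rewrite oplusE -ab.
have e0 : ecompl ezero = eone :> E.
  by symmetry; apply: ecompl_unique; apply: oplusC; exact: oplus10.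
rewrite e0 -oplus_optA; case be: (Some b [+] _) => [c|//].
have b0 : b = ezero := oplus_one be.
by move=> _; move: ab; rewrite b0 oplus_opt_r0 => -[].
Qed.

Lemma ele_oplusl a b c : Some a [+] Some b = Some c -> ele a c.
Proof. by exists b. Qed.

Lemma ele_oplusr a b c : Some a [+] Some b = Some c -> ele b c.
Proof. by rewrite oplus_optC; apply: ele_oplusl. Qed.

Lemma ele_refl a : ele a a.
Proof. exists ezero; exact: (oplus_opt_r0 (Some a)). Qed.

Lemma ele_trans b a c : ele a b -> ele b c -> ele a c.
Proof.
move=> [x ab] [y bc]; move: bc.
rewrite oplusE -ab oplusE.
by rewrite -oplus_optA; case xy: (_ [+] Some y) => [z|//]; exists z.
Qed.

Lemma ele0 a : ele ezero a.
Proof. by exists a; exact: (oplus_opt0 (Some a)). Qed.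

Lemma ele1 a : ele a eone.
Proof. by exists (ecompl a); exact: ecomplP. Qed.

Lemma ele_anti a b : ele a b -> ele b a -> a = b.
Proof.
move=> [x ab] [y ba]; have := ba.
rewrite oplusE -ab oplusE.
rewrite -oplus_optA => h; have := oplus_opt_cancel h (oplus_opt_r0 _).
by move=> /oplus_opt_eq0 x0; move: ab; rewrite x0 oplusE oplus_opt_r0 => -[].
Qed.

Lemma ele_zero a : ele a ezero -> a = ezero.
Proof. by move=> /ele_anti; apply; exact: ele0. Qed.

Lemma ecomplK a : ecompl (ecompl a) = a.
Proof. by symmetry; apply: ecompl_unique; apply: oplusC; exact: ecomplP. Qed.

Lemma ele_ecompl a b : ele a (ecompl b) <-> exists c, Some a [+] Some b = Some c.
Proof.
split=> [[x ax]|[c ab]].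
  have := ecomplP b; rewrite oplusE -ax.
  rewrite oplusE oplus_optA (oplus_optC (Some b)).
  by case/oplus_opt_defl=> c; exists c.
have := ecomplP c; rewrite oplusE -ab.
rewrite (oplus_optC (Some a)) -oplus_optA; case ac: (Some a [+] _) => [d|//].
by move=> /ecompl_unique <-; exists (ecompl c).
Qed.

Lemma ele_ecompl_sym a b : ele a (ecompl b) -> ele b (ecompl a).
Proof. by move=> /ele_ecompl ab; apply/ele_ecompl; rewrite oplus_optC. Qed.

Lemma ele_compl2 a b : ele a b -> ele (ecompl b) (ecompl a).
Proof. by move=> ab; apply: ele_ecompl_sym; rewrite ecomplK. Qed.

Lemma ele_cancel a b c x y : Some a [+] Some b = Some x -> Some a [+] Some c = Some y ->
  ele x y -> ele b c.
Proof.
move=> ab ac [d xd]; exists d; apply: (oplus_opt_cancel (a := a) _ ac).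
by rewrite oplusE oplus_optA ab.
Qed.

End OptionSum.

(** * Finite orthogonal sums *)

Section FiniteSums.
Variable E : effectAlgebraType.
Implicit Types (a b c q w x y z : E) (s t : option E) (I J K : finType).

Definition msum I (P : pred I) (v : I -> E) : option E :=
  \big[@oplus_opt E/Some ezero]_(i | P i) Some (v i).

Lemma eq_msum I (P Q : pred I) (v w : I -> E) :
  P =1 Q -> (forall i, P i -> v i = w i) -> msum P v = msum Q w.
Proof. by move=> PQ vw; apply: eq_big => // i /vw ->. Qed.

Lemma msumID I (Q P : pred I) (v : I -> E) :
  msum P v = msum (fun i => P i && Q i) v [+] msum (fun i => P i && ~~ Q i) v.
Proof. exact: (bigID Q). Qed.

Lemma msum_sub I (P Q : pred I) (v : I -> E) x : msum P v = Some x -> subpred Q P ->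
  exists2 y, msum Q v = Some y & ele y x.
Proof.
move=> + QP; rewrite (msumID Q).
rewrite (_ : msum _ v = msum Q v); last first.
  by apply: eq_msum => // i; case Qi: (Q i); rewrite ?andbF ?andbT ?QP.
case: (msum Q v) => [y|//]; case: (msum _ v) => [z|//] yz.
by exists y => //; exists z.
Qed.

Lemma msum_subD I (P Q : pred I) (v : I -> E) x y : msum P v = Some x ->
  msum Q v = Some y -> subpred Q P ->
  exists2 z, msum (fun i => P i && ~~ Q i) v = Some z & Some y [+] Some z = Some x.
Proof.
move=> Px Qy QP; move: Px; rewrite (msumID Q).
rewrite (_ : msum _ v = msum Q v); last first.
  by apply: eq_msum => // i; case Qi: (Q i); rewrite ?andbF ?andbT ?QP.
by rewrite Qy; case: (msum _ v) => [z|//] yz; exists z.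
Qed.

Lemma msumU I (P Q : pred I) (v : I -> E) : (forall i, P i -> ~~ Q i) ->
  msum (fun i => P i || Q i) v = msum P v [+] msum Q v.
Proof.
move=> PQ; rewrite (msumID P); congr (_ [+] _); apply: eq_msum => // i.
  by case: (P i) => //=; rewrite andbF.
case Pi: (P i) => /=; last by rewrite andbT.
by rewrite (negPf (PQ _ Pi)).
Qed.

Lemma msum1 I (v : I -> E) i : msum (pred1 i) v = Some (v i).
Proof. exact: big_pred1. Qed.

Lemma msum_ele I (P : pred I) (v : I -> E) x i : msum P v = Some x -> P i -> ele (v i) x.
Proof.
move=> Px Pi; have [|y] := @msum_sub _ P (pred1 i) v _ Px; first by move=> j /eqP ->.
by rewrite msum1 => -[->].
Qed.

Lemma msum0 I (P : pred I) (v : I -> E) : (forall i, P i -> v i = ezero) ->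
  msum P v = Some ezero.
Proof. by move=> v0; rewrite /msum big1 // => i /v0 ->. Qed.

Lemma msum_mkcond I (P : pred I) (v : I -> E) :
  msum P v = msum predT (fun i => if P i then v i else ezero).
Proof. by rewrite /msum big_mkcond; apply: eq_bigr => i _; case: ifP. Qed.

Lemma msum_split I (P : pred I) (v e r : I -> E) :
  (forall i, P i -> Some (e i) [+] Some (r i) = Some (v i)) ->
  msum P v = msum P e [+] msum P r.
Proof. by move=> h; rewrite /msum -big_split; apply: eq_bigr => i /h. Qed.

Lemma msum_bool (v : bool -> E) : msum predT v = Some (v true) [+] Some (v false).
Proof.
rewrite /msum (bigID id) (big_pred1 true) /=; last by case.
by rewrite (big_pred1 false) //; case.
Qed.

Definition refines_along I J (f : J -> I) (v : J -> E) (w : I -> E) : Prop :=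
  forall i, msum (fun j => f j == i) v = Some (w i).

Lemma msum_refines I J (f : J -> I) (v : J -> E) (w : I -> E) (P : pred I) :
  refines_along f v w -> msum (fun j => P (f j)) v = msum P w.
Proof.
move=> fvw; rewrite /msum (partition_big f P) //; apply: eq_bigr => i Pi.
rewrite -fvw; apply: eq_bigl => j; case: eqP => [->|]; by rewrite ?Pi ?andbF.
Qed.

Lemma refines_along_ele I J (f : J -> I) (v : J -> E) (w : I -> E) j :
  refines_along f v w -> ele (v j) (w (f j)).
Proof. by move=> /(_ (f j)) /msum_ele; apply; rewrite /=. Qed.

Lemma refines_along_comp I J K (f : J -> I) (g : K -> J) (u : K -> E) (v : J -> E) (w : I -> E) :
  refines_along f v w -> refines_along g u v -> refines_along (f \o g) u w.
Proof.
move=> fvw guv i; rewrite -(fvw i).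
exact: (msum_refines (fun j => f j == i) guv).
Qed.

Lemma refines_along_id I (v : I -> E) : refines_along id v v.
Proof. by move=> i; rewrite -(msum1 v); apply: eq_msum. Qed.

Lemma msum_pair I J (P : pred I) (Q : I -> pred J) (e : I -> J -> E) (w : I -> E) :
  (forall i, P i -> msum (Q i) (e i) = Some (w i)) ->
  msum (fun p : I * J => P p.1 && Q p.1 p.2) (fun p => e p.1 p.2) = msum P w.
Proof.
move=> h; rewrite /msum -(pair_big_dep P Q (fun i j => Some (e i j))).
by apply: eq_bigr => i /h.
Qed.

Lemma refines_along_fst I J (e : I -> J -> E) (u : I -> E) :
  (forall i, msum predT (e i) = Some (u i)) ->
  refines_along fst (fun p : I * J => e p.1 p.2) u.
Proof.
move=> h i; rewrite -(msum1 u) -(msum_pair (Q := fun _ => predT) (fun i _ => h i)).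
by apply: eq_msum => // -[k j] /=; rewrite andbT.
Qed.

Lemma msum_exchange I J (P : pred I) (Q : pred J) (e : I -> J -> E) (u : I -> E) (v : J -> E) :
  (forall i, P i -> msum Q (e i) = Some (u i)) ->
  (forall j, Q j -> msum P (e^~ j) = Some (v j)) -> msum P u = msum Q v.
Proof.
move=> hu hv; transitivity (\big[@oplus_opt E/Some ezero]_(i | P i) msum Q (e i)).
  by apply: eq_bigr => i /hu ->.
by rewrite /msum exchange_big; apply: eq_bigr => j /hv <-.
Qed.

Lemma refines_along_snd I J (e : I -> J -> E) (v : J -> E) :
  (forall j, msum predT (e^~ j) = Some (v j)) ->
  refines_along snd (fun p : I * J => e p.1 p.2) v.
Proof.
move=> h j; rewrite -(h j) /msum.
rewrite (reindex_onto (fun i => (i, j)) fst) /=; last by move=> [k l] /= /eqP ->.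
by apply: eq_bigl => i; rewrite !eqxx.
Qed.

Lemma refines_along_prod I J K (f : J -> I) (v : J -> K -> E) (w : I -> K -> E) :
  (forall k, refines_along f (v^~ k) (w^~ k)) ->
  refines_along (fun p : J * K => (f p.1, p.2)) (fun p => v p.1 p.2) (fun p => w p.1 p.2).
Proof.
move=> h [i k]; rewrite -(h k i).
rewrite -(msum_pair (P := fun j => f j == i) (Q := fun _ => pred1 k) (e := v)) //.
by move=> j _; exact: msum1.
Qed.

End FiniteSums.

(** * Splitting elements along sums *)

Section Splitting.
Variable E : effectAlgebraType.
Implicit Types (a b c q w x y z t s : E) (I J K : finType).

(** Two cases matter: [q = w'] for every [w], which is homogeneity, and
    [q = w = 1], which is the Riesz decomposition property. *)
Definition split_below q w : Prop := forall t r1 r2 s,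
  ele t q -> oplus r1 r2 = Some s -> ele t s -> ele s w ->
  exists t1 t2, [/\ ele t1 r1, ele t2 r2 & oplus t1 t2 = Some t].

Lemma homogeneous_split_below w : homogeneous E -> split_below (ecompl w) w.
Proof.
move=> hE t r1 r2 s tw rs ts sw; apply: (hE t r1 r2 s rs ts).
exact: ele_trans tw (ele_compl2 sw).
Qed.

Lemma split_seq q w (I : eqType) (l : seq I) (r : I -> E) : split_below q w -> uniq l ->
  forall t s, ele t q -> \big[@oplus_opt E/Some ezero]_(i <- l) Some (r i) = Some s ->
    ele t s -> ele s w ->
  exists2 e : I -> E, forall i, i \in l -> ele (e i) (r i) &
    \big[@oplus_opt E/Some ezero]_(i <- l) Some (e i) = Some t.
Proof.
move=> qw; elim: l => [_|i l IH /= /andP[il ul]] t s tq.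
  rewrite big_nil => -[<-] /ele_zero -> _; exists (fun=> ezero) => //.
  by rewrite big_nil.
rewrite big_cons; case Ds: (\big[_/_]_(_ <- _) _) => [s'|//] rs ts sw.
have [t1 [t2 [t1r t2s t12]]] := qw _ _ _ _ tq rs ts sw.
have [e er e2] := IH ul t2 s' (ele_trans (ele_oplusr t12) tq) Ds t2s
  (ele_trans (ele_oplusr rs) sw).
exists (fun j => if j == i then t1 else e j).
  move=> j; rewrite inE; case: eqP => [-> //|_ /=]; exact: er.
rewrite big_cons eqxx -t12 oplusE -e2; congr (_ [+] _).
by rewrite [LHS]big_seq [RHS]big_seq; apply: eq_bigr => j jl; case: eqP jl il => [-> ->|].
Qed.

Lemma split_msum q w I (P : pred I) (r : I -> E) t s : split_below q w ->
  ele t q -> msum P r = Some s -> ele t s -> ele s w ->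
  exists2 e : I -> E, forall i, ele (e i) (if P i then r i else ezero) &
    msum predT e = Some t.
Proof.
move=> qw tq; rewrite msum_mkcond => rs ts sw.
have [e er et] := split_seq qw (index_enum_uniq I) tq rs ts sw.
by exists e => // i; apply: er; rewrite mem_index_enum.
Qed.

(** The columns are carved out of the rows one at a time: each [v j] is split
    along what the previous columns have left of the rows. *)
Lemma split_columns q w (J : eqType) K (l : seq J) (v : J -> E) : split_below q w ->
  uniq l -> (forall j, j \in l -> ele (v j) q) ->
  forall (u : K -> E) x y, msum predT u = Some x -> ele x w ->
  \big[@oplus_opt E/Some ezero]_(j <- l) Some (v j) = Some y -> ele y x ->
  exists (e : K -> J -> E) (r : K -> E),
    (forall k, \big[@oplus_opt E/Some ezero]_(j <- l) Some (e k j) [+] Some (r k) = Some (u k)) /\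
    (forall j, j \in l -> msum predT (e^~ j) = Some (v j)).
Proof.
move=> qw; elim: l => [_ _|j l IH /= /andP[jl ul] vq] u x y ux xw.
  move=> _ _; exists (fun _ _ => ezero), u; split=> // k.
  by rewrite big_nil oplus_opt0.
rewrite big_cons; case Dy: (\big[_/_]_(_ <- _) _) => [y'|//] vy yx.
have vx : ele (v j) x := ele_trans (ele_oplusl vy) yx.
have vjq : ele (v j) q by apply: vq; rewrite mem_head.
have [c cu cv] := split_msum qw vjq ux vx xw.
have [u' u'P] := choice cu.
have Su := msum_split (P := predT) (fun k _ => u'P k).
rewrite ux cv in Su; case Dx': (msum predT u') Su => [x'|//] Su.
have yx' : ele y' x'.
  have [d yd] := yx.
  have yd' : Some y [+] Some d = Some x := yd.
  move: yd'; rewrite -[Some y]vy -oplus_optA; case yd': (Some y' [+] _) => [z|//].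
  move=> vz; have := oplus_opt_cancel vz (esym Su) => -[zx'].
  by exists d; rewrite -zx'.
have lq j' : j' \in l -> ele (v j') q by move=> j'l; apply: vq; rewrite inE j'l orbT.
have [e [r [er ev]]] := IH ul lq u' x' y' Dx' (ele_trans (ele_oplusr (esym Su)) xw) Dy yx'.
exists (fun k i => if i == j then c k else e k i), r; split=> [k|i].
  rewrite big_cons eqxx -oplus_optA.
  rewrite -(u'P k) oplusE -er; congr (_ [+] (_ [+] _)).
  by rewrite [LHS]big_seq [RHS]big_seq; apply: eq_bigr => i il; case: eqP il jl => [-> ->|].
by rewrite inE; case: eqP => [-> _|_ /= /ev].
Qed.

(** The column [j0] need not be below [q], because it is not carved out: it
    receives what the other columns leave of the rows. *)
Lemma common_refinement q w J K (j0 : J) (u : K -> E) (v : J -> E) : split_below q w ->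
  msum predT u = Some w -> msum predT v = Some w ->
  (forall j, j != j0 -> ele (v j) q) ->
  exists e : K -> J -> E, (forall k, msum predT (e k) = Some (u k)) /\
    (forall j, msum predT (e^~ j) = Some (v j)).
Proof.
move=> qw uw vw vq; pose l := [seq j <- index_enum J | j != j0].
have lq j : j \in l -> ele (v j) q by rewrite mem_filter => /andP[/vq].
have ul : uniq l by rewrite filter_uniq // index_enum_uniq.
have suml (F : J -> E) :
    \big[@oplus_opt E/Some ezero]_(j <- l) Some (F j) = msum (predC1 j0) F.
  by rewrite /msum big_filter; apply: eq_bigl.
have sumT (F : J -> E) : msum predT F = msum (predC1 j0) F [+] Some (F j0).
  by rewrite (msumID (pred1 j0)) oplus_optC -(msum1 F).
have := vw; rewrite sumT => /[dup] vy /oplus_opt_defl[y Dy].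
have [|e [r [er ev]]] := split_columns qw ul lq uw (ele_refl w) (etrans (suml v) Dy).
  by exists (v j0); rewrite Dy in vy.
exists (fun k j => if j == j0 then r k else e k j).
have He k : msum (predC1 j0) (fun j => if j == j0 then r k else e k j) = msum (predC1 j0) (e k).
  by apply: eq_msum => // j /= /negPf ->.
split=> [k|j]; first by rewrite sumT eqxx He -suml er.
have [->|jj0] := eqVneq j j0; last by apply: ev; rewrite mem_filter jj0 mem_index_enum.
(* Both [v j0] and the sum of the remainders complete the other columns to [w]. *)
pose d k := odflt ezero (msum (predC1 j0) (e k)).
have dP k : msum (predC1 j0) (e k) = Some (d k).
  by rewrite /d; have := er k; rewrite suml => /oplus_opt_defl[z ->].
have dy : msum predT d = Some y.
  rewrite -Dy; apply: (msum_exchange (e := e)) => // i ij0.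
  by apply: ev; rewrite mem_filter mem_index_enum andbT.
rewrite Dy in vy; apply: (oplus_opt_cancel _ vy).
by rewrite -dy -(msum_split (v := u)) // => k _; rewrite -er suml dP.
Qed.

Lemma msum_eq0 I (P : pred I) (v : I -> E) i : msum P v = Some ezero -> P i -> v i = ezero.
Proof. by move=> v0 /(msum_ele v0) /ele_zero. Qed.

Lemma common_refinement1 J K (u : K -> E) (v : J -> E) : split_below (eone : E) eone ->
  msum predT u = Some eone -> msum predT v = Some eone ->
  exists e : K -> J -> E, (forall k, msum predT (e k) = Some (u k)) /\
    (forall j, msum predT (e^~ j) = Some (v j)).
Proof.
move=> q1 u1 v1; have [j0 _|J0] := pickP (@predT J).
  by apply: (common_refinement (j0 := j0) q1) => // j _; exact: ele1.
(* An empty [J] forces [0 = 1]. *)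
have E0 : ezero = eone :> E by have := v1; rewrite /msum big_pred0 // => -[].
exists (fun _ _ => ezero); split=> [k|j]; last by have := J0 j.
by rewrite msum0 // (@msum_eq0 _ predT u) // E0.
Qed.

End Splitting.

(** * Directed sets of partitions of unity *)

Section Words.
Variable E : effectAlgebraType.
Implicit Types (a b c x y z t s : E) (I J K : finType).

(** Indexing by ordinals, instead of arbitrary finite types, keeps words in the
    universe of the algebra, so that sets of words can be formed. *)
Record word := Word { wsize : nat; wval :> 'I_wsize -> E }.
Implicit Types (U V W : word) (D : set word).

Definition word_of I (v : I -> E) : word := Word (fun i : 'I_#|I| => v (enum_val i)).

Lemma word_of_refines I (v : I -> E) : refines_along enum_val (word_of v) v.
Proof.
move=> i; rewrite -[in RHS](enum_rankK i) -(msum1 (word_of v)); apply: eq_msum => // j /=.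
by apply/eqP/eqP => [<-|->]; rewrite ?enum_valK ?enum_rankK.
Qed.

Lemma refines_word_of I (v : I -> E) : refines_along enum_rank v (word_of v).
Proof.
move=> i; rewrite -(msum1 v); apply: eq_msum => // j /=.
by apply/eqP/eqP => [<-|->]; rewrite ?enum_valK ?enum_rankK.
Qed.

Definition refines V W : Prop := exists f : 'I_(wsize V) -> 'I_(wsize W), refines_along f V W.

Lemma refines_refl W : refines W W.
Proof. by exists id; exact: refines_along_id. Qed.

Lemma refines_trans V U W : refines U V -> refines V W -> refines U W.
Proof. by move=> [g gUV] [f fVW]; exists (f \o g); exact: refines_along_comp gUV. Qed.

Lemma refines_of W I (f : I -> 'I_(wsize W)) (v : I -> E) : refines_along f v W ->
  refines (word_of v) W.
Proof. by move=> fvW; exists (f \o enum_val); apply: refines_along_comp fvW (word_of_refines v). Qed.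

Definition directed D : Prop :=
  (forall W, D W -> msum predT W = Some eone) /\
  forall W1 W2, D W1 -> D W2 -> exists W3, [/\ D W3, refines W3 W1 & refines W3 W2].

Definition maximal_directed D : Prop :=
  [/\ directed D, exists W, D W & forall D', directed D' -> D `<=` D' -> D' `<=` D].

Definition subsums D : set E := [set x | exists W, D W /\ exists P, msum P W = Some x].

(** Zorn's lemma is applied to the sets [A] with [D `|` A] directed, so that the
    union of the empty chain qualifies too. *)
Lemma directed_maximal D : directed D -> (exists W, D W) ->
  exists2 D', maximal_directed D' & D `<=` D'.
Proof.
move=> dD [W0 D0].
have [F chF totF|A [dA maxA]] := @Zorn_bigcup word [set A | directed (D `|` A)].
  have stage W W' : (D `|` \bigcup_(Y in F) Y) W -> (D `|` \bigcup_(Y in F) Y) W' ->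
      exists X, [/\ directed X, X W, X W' & X `<=` D `|` \bigcup_(Y in F) Y].
    have sub Y : F Y -> D `|` Y `<=` D `|` \bigcup_(Y in F) Y.
      by move=> FY V [|YV]; [left|right; exists Y].
    move=> [DW|[X FX XW]] [DW'|[Y FY YW']].
    - by exists D; split=> // V; left.
    - by exists (D `|` Y); split; [exact: chF|left|right|exact: sub].
    - by exists (D `|` X); split; [exact: chF|right|left|exact: sub].
    - have [XY|YX] := totF _ _ FX FY.
        by exists (D `|` Y); split; [exact: chF|right; exact: XY|right|exact: sub].
      by exists (D `|` X); split; [exact: chF|right|right; exact: YX|exact: sub].
  split=> [W DW|W1 W2 DW1 DW2]; first by have [X [[]]] := stage _ _ DW DW; auto.
  have [X [[_ dX] XW1 XW2 XD]] := stage _ _ DW1 DW2.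
  by have [W3 [XW3 r1 r2]] := dX _ _ XW1 XW2; exists W3; split=> //; exact: XD.
exists (D `|` A); last by left.
split=> [//||D' dD' sub]; first by exists W0; left.
have AD' : A `<=` D' by move=> W AW; apply: sub; right.
have DD' : D `|` D' = D' by apply/seteqP; split=> [W [DW|//]|W]; [apply: sub; left|right].
apply: contrapT => nsub; apply: (maxA D'); last by rewrite /= DD'.
by split=> // D'A; apply: nsub => W /D'A; right.
Qed.

Lemma refines_msum V W P x : refines V W -> msum P W = Some x -> exists Q, msum Q V = Some x.
Proof. by move=> [f fVW] Px; exists (fun j => P (f j)); rewrite (msum_refines P fVW). Qed.

(** ** Isotropic refinements *)

(** Each part [w] of [W] is cut into pieces that are all below [w'], except
    perhaps the single piece chosen by [g].  An element below [w] and [w'] is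
    split by homogeneity along any refinement of [w], so that two refinements
    of this kind always have a common one; this fails for arbitrary
    refinements. *)
Definition isotropic_refinement I J (f : J -> I) (g : I -> J) (v : J -> E) (w : I -> E) : Prop :=
  [/\ refines_along f v w, cancel g f &
      forall j, j != g (f j) -> ele (v j) (ecompl (w (f j)))].

Lemma isotropic_refinement_id I (v : I -> E) : isotropic_refinement id id v v.
Proof. by split=> // [|j]; [exact: refines_along_id|rewrite eqxx]. Qed.

(** The index maps are explicit so that the lemma can be iterated: it refines
    [u], which already refines [w] isotropically, by one more isotropic
    refinement [v] of a coarser family [w']. *)
Lemma common_isotropic_refinement I I' J K (f : K -> I) (g : I -> K) (h : I -> I')
    (f' : J -> I') (g' : I' -> J) (u : K -> E) (v : J -> E) (w : I -> E) (w' : I' -> E) :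
  homogeneous E -> isotropic_refinement f g u w -> refines_along h w w' ->
  isotropic_refinement f' g' v w' ->
  exists e : K * J -> E, [/\ refines_along fst e u, refines_along snd e v &
    isotropic_refinement (f \o fst) (fun i => (g i, g' (h i))) e w].
Proof.
move=> hE [fuw gK iu] hww' [f'vw' g'K iv].
have hfuw' := refines_along_comp hww' fuw.
(* Over each [i : I'] the parts of [u] and of [v] have the same sum [w' i];
   families over other indices are padded with zeros. *)
have /choice[e /all_and2[eu ev]] (i : I') : exists e : K -> J -> E,
    (forall k, msum predT (e k) = Some (if h (f k) == i then u k else ezero)) /\
    (forall j, msum predT (e^~ j) = Some (if f' j == i then v j else ezero)).
  apply: (@common_refinement _ _ _ _ _ (g' i) (fun k => if h (f k) == i then u k else ezero)
    (fun j => if f' j == i then v j else ezero) (homogeneous_split_below (w := w' i) hE)).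
  - by rewrite -msum_mkcond -(hfuw' i).
  - by rewrite -msum_mkcond -(f'vw' i).
  move=> j jg; have [fj|_] := eqVneq (f' j) i; last exact: ele0.
  by rewrite -fj; apply: iv; rewrite fj.
pose d k j := e (h (f k)) k j.
have du k : msum predT (d k) = Some (u k) by rewrite eu eqxx.
have d0 k j : h (f k) != f' j -> d k j = ezero.
  move=> kj; have := ev (h (f k)) j; rewrite eq_sym (negPf kj).
  by move/msum_eq0; apply.
have dv j : msum predT (d^~ j) = Some (v j).
  have := ev (f' j) j; rewrite eqxx => <-; apply: eq_msum => // k _.
  rewrite /d; case: (eqVneq (h (f k)) (f' j)) => [-> //|kj].
  rewrite -/(d k j) d0 //; have := eu (f' j) k; rewrite (negPf kj).
  by move/msum_eq0 => -> .
exists (fun p => d p.1 p.2); split.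
- exact: refines_along_fst.
- exact: refines_along_snd.
split=> [|i //=|[k j] /= kj]; first exact: refines_along_comp fuw (refines_along_fst du).
have [kg|kg] := eqVneq k (g (f k)); last first.
  by apply: ele_trans (iu _ kg); exact: (msum_ele (du k)).
have [hj|/d0->] := eqVneq (h (f k)) (f' j); last exact: ele0.
have jg : j != g' (f' j).
  by apply: contraNneq kj => jg; rewrite -kg hj -jg.
apply: ele_trans (msum_ele (dv j) _) _ => //; apply: ele_trans (iv j jg) _.
by apply: ele_compl2; rewrite -hj; exact: (refines_along_ele (f k) hww').
Qed.

Lemma isotropic_refinement_word I J (f : J -> I) (g : I -> J) (v : J -> E) (w : I -> E) :
  isotropic_refinement f g v w ->
  isotropic_refinement (f \o enum_val) (enum_rank \o g) (word_of v) w.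
Proof.
move=> [fvw gK iv]; split=> [|i /=|j /= jg].
- exact: refines_along_comp fvw (word_of_refines v).
- by rewrite enum_rankK gK.
by apply: iv; apply: contraNneq jg => <-; rewrite enum_valK.
Qed.

Section Maximal.
Hypothesis hE : homogeneous E.
Variable D : set word.
Hypothesis maxD : maximal_directed D.

Let dD : directed D. Proof. by case: maxD. Qed.

(** Given isotropic refinements of two words of [D], a common refinement in [D]
    of these words is refined isotropically by the one and then by the other. *)
Lemma maximal_isotropic_refinement V W f g : D W -> isotropic_refinement f g V W -> D V.
Proof.
pose D' : set word := [set V | exists W, D W /\
  exists (f : 'I_(wsize V) -> 'I_(wsize W)) g, isotropic_refinement f g V W].
have DD' : D `<=` D'.
  by move=> V' DV'; exists V'; split=> //; exists id, id; exact: isotropic_refinement_id.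
move=> DW fg; have [_ _ /(_ D') maxD'] := maxD.
apply: (maxD' _ DD'); last by exists W; split=> //; exists f, g.
move=> {f g fg V W DW maxD'}.
split=> [V [W [DW [f [g [fVW _ _]]]]]|V1 V2 [W1 [D1 [f1 [g1 i1]]]] [W2 [D2 [f2 [g2 i2]]]]].
  by rewrite (msum_refines predT fVW); apply: dD.1.
have [W3 [D3 [h1 r1] [h2 r2]]] := dD.2 _ _ D1 D2.
have [e1 [_ e1V1 i3]] := common_isotropic_refinement hE (isotropic_refinement_id W3) r1 i1.
have [e2 [e2e1 e2V2 i4]] := common_isotropic_refinement hE i3 r2 i2.
exists (word_of e2); split.
- by exists W3; split=> //; do 2!eexists; exact: isotropic_refinement_word i4.
- exact: refines_of (refines_along_comp e1V1 e2e1).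
- exact: refines_of e2V2.
Qed.

(** Homogeneity cuts [t] into isotropic pieces of the entries that add up to
    [s], and the word with these pieces is an isotropic refinement of [W]. *)
Lemma maximal_split W P s t : D W -> msum P W = Some s -> ele t s -> ele t (ecompl s) ->
  exists V (f : 'I_(wsize V) -> 'I_(wsize W)) Q,
    [/\ D V, refines_along f V W, subpred Q (fun j => P (f j)) & msum Q V = Some t].
Proof.
move=> DW Ps ts ts'.
have [e eW et] := split_msum (homogeneous_split_below (w := s) hE) ts' Ps ts (ele_refl s).
have eP i : ~~ P i -> e i = ezero.
  by move=> Pi; apply: ele_zero; have := eW i; rewrite (negPf Pi).
have /choice[r rP] i : exists r, Some (e i) [+] Some r = Some (W i).
  have := eW i; case: ifP => // _ /ele_zero ->; exists (W i); exact: oplus_opt0.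
pose v (p : 'I_(wsize W) * bool) := if p.2 then e p.1 else r p.1.
have fv : refines_along fst v W.
  by apply: (refines_along_fst (e := fun i (b : bool) => if b then e i else r i)) => i; rewrite msum_bool.
have iv : isotropic_refinement fst (fun i => (i, false)) v W.
  split=> // -[i [|]] /=; rewrite ?eqxx // => _.
  case Pi: (P i); last by rewrite /v /= eP ?Pi //; exact: ele0.
  apply: ele_trans (msum_ele et _) _ => //; apply: ele_trans ts' _.
  by apply: ele_compl2; exact: msum_ele Ps Pi.
exists (word_of v), (fst \o enum_val), (fun j => P (enum_val j).1 && (enum_val j).2).
split=> [||j /andP[] //|].
- exact: (maximal_isotropic_refinement (V := word_of v) DW (isotropic_refinement_word iv)).
- exact: refines_along_comp fv (word_of_refines v).
rewrite (msum_refines (fun p => P p.1 && p.2) (word_of_refines v)) -et.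
transitivity (msum P e).
  rewrite -(msum_pair (P := P) (Q := fun _ => id) (e := fun i (b : bool) => if b then e i else r i)) //.
  by move=> i _; rewrite -(msum1 (fun b : bool => if b then e i else r i) true); apply: eq_msum => // -[].
by rewrite msum_mkcond; apply: eq_msum => // i _; case: ifPn => // /eP.
Qed.

(** Two subsums [a <= s] of a word need not be nested: their overlap cancels,
    and what remains of [a] is below and orthogonal to what remains of [s]. *)
Lemma maximal_nested W S A s a : D W -> msum S W = Some s -> msum A W = Some a -> ele a s ->
  exists V (f : 'I_(wsize V) -> 'I_(wsize W)) Q,
    [/\ D V, refines_along f V W, subpred Q (fun j => S (f j)) & msum Q V = Some a].
Proof.
move=> DW Ss Aa a_s.
have [z Dz _] : exists2 z, msum (fun i => S i && A i) W = Some z & ele z s.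
  by apply: msum_sub Ss _ => i /andP[].
have Ds1 := Ss; rewrite (msumID A) Dz in Ds1.
have Da1 := Aa; rewrite (msumID S) (eq_msum (Q := fun i => S i && A i) (w := W)) in Da1; first last.
- by [].
- by move=> i; rewrite andbC.
rewrite Dz in Da1.
have disj i : A i && ~~ S i -> ~~ (S i && ~~ A i) by case/andP=> ->; rewrite andbF.
have [u Du _] := msum_sub (dD.1 _ DW) (Q := fun i => A i && ~~ S i || S i && ~~ A i) (fun _ _ => isT).
move: Du Da1 Ds1; rewrite msumU //.
case Da1: (msum _ W) => [a1|//]; case Ds1: (msum _ W) => [s1|//] a1s1 za1 zs1.
have a1s1' : ele a1 (ecompl s1) by apply/ele_ecompl; exists u.
have [V [f [Q [DV fVW QS Qa1]]]] := maximal_split DW Ds1 (ele_cancel za1 zs1 a_s) a1s1'.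
exists V, f, (fun j => S (f j) && A (f j) || Q j); split=> //.
  by move=> j /orP[/andP[]|/QS /andP[]].
rewrite msumU; last first.
  by move=> j /andP[_ Aj]; apply/negP => /QS; rewrite Aj andbF.
by rewrite Qa1 (msum_refines (fun i => S i && A i) fVW) Dz.
Qed.

Lemma subsums2 x y : subsums D x -> subsums D y ->
  exists W P Q, [/\ D W, msum P W = Some x & msum Q W = Some y].
Proof.
move=> [W1 [D1 [P1 xP]]] [W2 [D2 [P2 yP]]]; have [W [DW r1 r2]] := dD.2 _ _ D1 D2.
have [P Px] := refines_msum r1 xP; have [Q Qy] := refines_msum r2 yP.
by exists W, P, Q.
Qed.

Lemma maximal_subsums_closed : sub_effect_algebra (subsums D).
Proof.
split.
  by have [_ [W DW] _] := maxD; exists W; split=> //; exists predT; apply: dD.1.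
move=> a b c /subsums2 /[apply] -[W [P [Q [DW Pa Qb]]]] bc.
have [V [f [R [DV fVW RP Rb]]]] := maximal_nested DW Pa Qb (ele_oplusl bc).
rewrite -(msum_refines P fVW) in Pa.
have [c' Dc' bc'] := msum_subD Pa Rb RP.
exists V; split=> //; exists (fun i => P (f i) && ~~ R i); rewrite Dc'; by rewrite (oplus_cancel bc' bc).
Qed.

Definition subsums_algebra : subEffectAlgebra E := SubEffectAlgebra maximal_subsums_closed.

(** Once [v1] and [u] are nested below the same representation of [s], the
    parts of [u] are distributed over [v1] and its complement in [s]. *)
Lemma maximal_subsums_riesz u v1 v2 s :
  subsums D u -> subsums D v1 -> subsums D v2 -> oplus v1 v2 = Some s -> ele u s ->
  exists u1 u2, [/\ subsums D u1, subsums D u2, ele u1 v1, ele u2 v2 & oplus u1 u2 = Some u].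
Proof.
move=> Du Dv1 Dv2 vs us.
have Ds : subsums D s := subea_oplus (B := subsums_algebra) Dv1 Dv2 vs.
have [W1 [D1 [P1 uP1]]] := Du.
have [W2 [S2 [V2 [D2 sS2 vV2]]]] := subsums2 Ds Dv1.
have [W [DW r1 [h r2]]] := dD.2 _ _ D1 D2.
have [U uU] := refines_msum r1 uP1.
rewrite -(msum_refines S2 r2) in sS2; rewrite -(msum_refines V2 r2) in vV2.
have [W3 [f [A [D3 fW AS vA]]]] := maximal_nested DW sS2 vV2 (ele_oplusl vs).
rewrite -(msum_refines _ fW) in sS2; rewrite -(msum_refines _ fW) in uU.
have [W4 [g [B [D4 gW BS uB]]]] := maximal_nested D3 sS2 uU us.
rewrite -(msum_refines _ gW) in sS2; rewrite -(msum_refines _ gW) in vA.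
have [v2' Dv2' vs'] := msum_subD sS2 vA (fun j => AS (g j)).
have v22 := oplus_cancel vs' vs; subst v2'.
have [u1 Du1 u1v] : exists2 u1, msum (fun j => B j && A (g j)) W4 = Some u1 & ele u1 v1.
  by apply: msum_sub vA _ => j /andP[].
have [u2 Du2 u2v] : exists2 u2, msum (fun j => B j && ~~ A (g j)) W4 = Some u2 & ele u2 v2.
  by apply: msum_sub Dv2' _ => j /andP[Bj Aj]; rewrite Aj andbT; apply: BS.
exists u1, u2; split=> //.
- by exists W4; split=> //; eexists; exact: Du1.
- by exists W4; split=> //; eexists; exact: Du2.
by rewrite oplusE -Du1 -Du2 -msumID.
Qed.

End Maximal.
End Words.

(** * Blocks *)

Section RieszSubalgebras.
Variable E : effectAlgebraType.
Implicit Types (a b c x y z t s : E) (I J K : finType) (B : subEffectAlgebra E).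

Lemma riesz_split_below (A : effectAlgebraType) :
  riesz_decomposition A <-> split_below (eone : A) eone.
Proof.
split=> [rE t r1 r2 s _ rs ts _|sE n u v w vw uw].
  pose r (i : 'I_2) := if val i == 0 then r1 else r2.
  have rsum : osum r = Some s by rewrite /osum !big_ord_recl big_ord0 oplus_opt_r0.
  have [e er] := rE 1 t r s rsum ts.
  rewrite /osum !big_ord_recl big_ord0 oplus_opt_r0 => et.
  by do 2!eexists; split; [exact: (er ord0)|exact: (er (lift ord0 ord0))|exact: et].
have [e ev eu] := split_msum (P := predT) sE (ele1 u) vw uw (ele1 w).
by exists e.
Qed.

Definition subea_mk B x (Bx : subea_set B x) : subea_sort B := exist _ x (mem_set Bx).

Lemma subea_oplusP B (x y z : subea_sort B) :
  oplus x y = Some z <-> oplus (subea_val x) (subea_val y) = Some (subea_val z).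
Proof. exact: (subea_plusP x y z). Qed.

Lemma subea_ele B (x y : subea_sort B) : ele x y <-> ele (subea_val x) (subea_val y).
Proof.
split=> [[c /subea_oplusP xc]|[c xc]]; first by exists (subea_val c).
by exists (subea_mk (subea_diff (subea_valP y) (subea_valP x) xc)); apply/subea_oplusP.
Qed.

Lemma subea_ecompl B (x : subea_sort B) : subea_val (ecompl x) = ecompl (subea_val x).
Proof.
by apply: ecompl_unique; apply: (iffLR (subea_oplusP x (ecompl x) eone)); exact: ecomplP.
Qed.

Lemma msum_subea_val B I (P : pred I) (v : I -> subea_sort B) :
  msum P (fun i => subea_val (v i)) = omap (@subea_val E B) (msum P v).
Proof.
rewrite /msum (big_morph (omap (@subea_val E B)) (op1 := @oplus_opt E) (id1 := Some ezero)) //.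
by move=> [x|] [y|] //=; exact: subea_plusE.
Qed.

Lemma riesz_subeaP B : riesz_decomposition (subea_sort B) <->
  (forall u v1 v2 s, subea_set B u -> subea_set B v1 -> subea_set B v2 ->
     oplus v1 v2 = Some s -> ele u s ->
     exists u1 u2, [/\ subea_set B u1, subea_set B u2, ele u1 v1, ele u2 v2 & oplus u1 u2 = Some u]).
Proof.
rewrite riesz_split_below; split=> [sB u v1 v2 s Bu Bv1 Bv2 vs us|rB t r1 r2 s _ rs ts _].
  have Bs := subea_oplus Bv1 Bv2 vs.
  have vs' : oplus (subea_mk Bv1) (subea_mk Bv2) = Some (subea_mk Bs) by exact/subea_oplusP.
  have us' : ele (subea_mk Bu) (subea_mk Bs) by exact/subea_ele.
  have [u1 [u2 [/subea_ele u1v /subea_ele u2v /subea_oplusP u12]]] :=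
    sB _ _ _ _ (ele1 _) vs' us' (ele1 _).
  by exists (subea_val u1), (subea_val u2); split=> //; exact: subea_valP.
move/subea_oplusP: rs => rs; move/subea_ele: ts => ts.
have [t1 [t2 [Bt1 Bt2 t1r t2r tt]]] :=
  rB _ _ _ _ (subea_valP t) (subea_valP r1) (subea_valP r2) rs ts.
by exists (subea_mk Bt1), (subea_mk Bt2); split; [exact/subea_ele|exact/subea_ele|exact/subea_oplusP].
Qed.

Definition words_in (S : set E) : set (word E) :=
  [set W : word E | (forall i, S (W i)) /\ msum predT W = Some eone].

(** The entries of the matrix of common parts lie in [B], since it is formed in
    the algebra [B]. *)
Lemma words_in_directed B : riesz_decomposition (subea_sort B) -> directed (words_in B).
Proof.
move=> /riesz_split_below sB; split=> [W []//|W1 W2 [BW1 W1s] [BW2 W2s]].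
have lift (W : word E) (BW : forall i, subea_set B (W i)) : msum predT W = Some eone ->
    msum predT (fun i => subea_mk (BW i)) = Some eone.
  move=> Ws; have := msum_subea_val predT (fun i => subea_mk (BW i)).
  rewrite [LHS]Ws; case: (msum _ _) => [x|//] [x1].
  by congr Some; apply: subea_val_inj.
have [e [eW1 eW2]] := common_refinement1 sB (lift _ BW1 W1s) (lift _ BW2 W2s).
pose v p := subea_val (e p.1 p.2).
have r1 : refines_along fst v W1.
  by apply: (refines_along_fst (e := fun k j => subea_val (e k j))) => k; rewrite msum_subea_val eW1.
have r2 : refines_along snd v W2.
  by apply: (refines_along_snd (e := fun k j => subea_val (e k j))) => j; rewrite msum_subea_val eW2.
exists (word_of v); split; [|exact: refines_of r1|exact: refines_of r2].
split=> [i|]; first exact: subea_valP.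
by rewrite (msum_refines predT (word_of_refines v)) (msum_refines predT r1).
Qed.

Definition pair_word a b : word E := word_of (fun c : bool => if c then a else b).

Lemma msum_pair_word a b : msum predT (pair_word a b) = Some a [+] Some b.
Proof. by rewrite (msum_refines predT (word_of_refines _)) msum_bool. Qed.

Lemma pair_word_in (S : set E) a b : oplus a b = Some eone -> S a -> S b ->
  words_in S (pair_word a b).
Proof.
move=> ab Sa Sb; split; last by rewrite msum_pair_word.
by move=> i; rewrite /pair_word /=; case: (enum_val i).
Qed.

Lemma subsums_elt (D : set (word E)) W i : D W -> subsums D (W i).
Proof. by move=> DW; exists W; split=> //; exists (pred1 i); exact: msum1. Qed.

Lemma subsums_pair_word (D : set (word E)) a b : D (pair_word a b) -> subsums D a /\ subsums D b.
Proof.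
move=> Dab; split.
  by have := subsums_elt (W := pair_word a b) (enum_rank true) Dab; rewrite /= enum_rankK.
by have := subsums_elt (W := pair_word a b) (enum_rank false) Dab; rewrite /= enum_rankK.
Qed.

Lemma words_in_exists B : exists W, words_in B W.
Proof.
exists (pair_word eone ezero); apply: pair_word_in; first exact: oplus10.
  exact: subea_one.
exact: subea_zero.
Qed.

Lemma subsums_words_in B : subea_set B `<=` subsums (words_in B).
Proof.
move=> x Bx; apply: (subsums_pair_word (b := ecompl x) _).1.
apply: pair_word_in => //; first exact: ecomplP.
exact: subea_compl Bx (ecomplP x).
Qed.

Lemma subsumsS (D D' : set (word E)) : D `<=` D' -> subsums D `<=` subsums D'.
Proof. by move=> DD' x [W [/DD' DW PW]]; exists W. Qed.

Hypothesis hE : homogeneous E.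

Lemma subsums_algebra_riesz D (maxD : maximal_directed D) :
  riesz_decomposition (subea_sort (subsums_algebra hE maxD)).
Proof. by apply/riesz_subeaP => u v1 v2 s; exact: maximal_subsums_riesz. Qed.

(** A larger subalgebra [C] with the Riesz property gives a directed set
    containing [D], hence equal to [D], and [D] determines [C]. *)
Lemma subsums_algebra_block D (maxD : maximal_directed D) : block (subsums_algebra hE maxD).
Proof.
split=> [|C rC DC x Cx]; first exact: subsums_algebra_riesz.
have [[Dsum _] _ maxD'] := maxD.
apply: (subsumsS (maxD' _ (words_in_directed rC) _)); last exact: subsums_words_in.
by move=> W DW; split=> [i|]; [apply: DC; exact: subsums_elt|exact: Dsum].
Qed.

Lemma block_subsums B : block B -> exists2 D, maximal_directed D & subea_set B = subsums D.
Proof.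
move=> [rB maxB].
have [D maxD BD] := directed_maximal (words_in_directed rB) (words_in_exists B).
exists D => //; have sub : B `<=` subsums D.
  by apply: (subset_trans (@subsums_words_in B)); exact: subsumsS.
apply/seteqP; split=> //.
by apply: (maxB (subsums_algebra hE maxD)) => //; exact: subsums_algebra_riesz.
Qed.

(** The single word [x, y, (x (+) y)'] is a directed set by itself. *)
Lemma orthogonal_block x y z : oplus x y = Some z ->
  exists B, [/\ block B, subea_set B x & subea_set B y].
Proof.
move=> xy; pose v (i : option bool) := if i is Some c then if c then x else y else ecompl z.
have v1 : msum predT v = Some eone.
  rewrite /msum (bigD1 None) //= (reindex_onto Some (odflt true)) /=; last by case.
  rewrite (eq_bigl predT) => [|c]; last by rewrite eqxx.
  rewrite -[\big[_/_]_(_ | _) _]/(msum predT (fun c : bool => if c then x else y)) msum_bool.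
  by rewrite -[_ [+] Some y]/(oplus x y) xy (oplusC (ecomplP z)).
have dD : directed [set word_of v].
  split=> [_ ->|_ _ -> ->]; first by rewrite (msum_refines predT (word_of_refines v)).
  by exists (word_of v); split=> //; exact: refines_refl.
have [D maxD vD] := directed_maximal dD (ex_intro _ _ erefl).
exists (subsums_algebra hE maxD); split; first exact: subsums_algebra_block.
  by have := subsums_elt (W := word_of v) (enum_rank (Some true)) (vD _ erefl); rewrite /= enum_rankK.
by have := subsums_elt (W := word_of v) (enum_rank (Some false)) (vD _ erefl); rewrite /= enum_rankK.
Qed.

(** The element [x] is split off from a word of the maximal directed set that
    represents [a]. *)
Lemma block_isotropic B a x : block B -> subea_set B a -> ele x a -> ele x (ecompl a) ->
  subea_set B x.
Proof.
move=> /block_subsums[D maxD ->] [W [DW [P Pa]]] xa xa'.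
have [V [f [Q [DV _ _ Qx]]]] := maximal_split hE maxD DW Pa xa xa'.
by exists V; split=> //; exists Q.
Qed.

End RieszSubalgebras.

(** * Central elements *)

Section Central.
Variable E : effectAlgebraType.
Implicit Types (a b c x y z t s : E) (I J K : finType) (B : subEffectAlgebra E).

Lemma principal_msum a I (P : pred I) (v : I -> E) x : principal a ->
  (forall i, P i -> ele (v i) a) -> msum P v = Some x -> ele x a.
Proof.
move=> pa va; move: x; rewrite /msum.
apply: (big_ind (fun s : option E => forall x, s = Some x -> ele x a)) => [x [<-]|s t IHs IHt x|i /va ia x [<-] //].
  exact: ele0.
case: s t IHs IHt => [s|] [t|] // IHs IHt st.
exact: pa (IHs _ erefl) (IHt _ erefl) st.
Qed.

(** If [x <= a] and [x <= a'], then [x (+) a] exists and lies below [a]. *)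
Lemma principal_sharp a : principal a -> sharp_element a.
Proof.
move=> pa x xa /ele_ecompl[z xaz].
have za := pa _ _ _ xa (ele_refl a) xaz.
have az : ele a z := ele_oplusr xaz.
have {za az} za := ele_anti za az; rewrite za oplus_optC in xaz.
by have := oplus_opt_cancel xaz (oplus_opt_r0 _) => -[].
Qed.

(** Uniqueness of the decompositions along [a] is automatic: any [x <= b] with
    [x <= a] is orthogonal to the complement [r] of [c1] in [a], hence
    [x (+) r <= a] by principality, that is, [x <= c1]. *)
Lemma principal_decomposition_max a b c1 c2 x : principal a ->
  ele c1 a -> ele c2 (ecompl a) -> oplus c1 c2 = Some b -> ele x b -> ele x a -> ele x c1.
Proof.
move=> pa [r cr] c2a cb xb xa.
have xr : ele r (ecompl b).
  apply/ele_ecompl; rewrite -[Some b]cb oplusE.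
  rewrite oplus_optA (oplus_optC (Some r)) -[Some c1 [+] _]/(oplus c1 r) cr oplus_optC.
  exact/ele_ecompl.
have [w xrw] : exists w, Some x [+] Some r = Some w.
  by apply/ele_ecompl; apply: ele_trans xb _; exact: ele_ecompl_sym.
have wa : ele w a by apply: pa xrw => //; exists c1; exact: oplusC.
have cr' : Some r [+] Some c1 = Some a := oplusC cr.
by rewrite oplus_optC in xrw; exact: (ele_cancel xrw cr' wa).
Qed.

Lemma principal_central a : principal a -> principal (ecompl a) ->
  (forall b, exists c1 c2, [/\ ele c1 a, ele c2 (ecompl a) & oplus c1 c2 = Some b]) ->
  central a.
Proof.
move=> pa pa' dec; split=> // b; have [c1 [c2 [c1a c2a cb]]] := dec b.
exists (c1, c2); split=> // -[d1 d2] /= [d1a d2a db].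
have d1c : d1 = c1.
  apply: ele_anti.
    exact: principal_decomposition_max pa c1a c2a cb (ele_oplusl db) d1a.
  exact: principal_decomposition_max pa d1a d2a db (ele_oplusl cb) c1a.
rewrite -d1c in cb *; congr (_, _).
exact: oplus_cancel cb db.
Qed.

Section Projections.
Variables (z : E) (p q : E -> E).
Hypotheses (cz : central z)
  (pq : forall b, [/\ ele (p b) z, ele (q b) (ecompl z) & oplus (p b) (q b) = Some b]).

Lemma central_projection_unique b s t :
  ele s z -> ele t (ecompl z) -> oplus s t = Some b -> s = p b /\ t = q b.
Proof.
move=> sz tz st; have [_ _ /(_ b)[[d1 d2] [_ u]]] := cz.
have [<- <-] := u (s, t) (And3 sz tz st).
by have [] := u (p b, q b) (pq b).
Qed.

(** The projections on the two factors are additive, because both [z] and [z']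
    are principal. *)
Lemma central_projection_msum I (P : pred I) (v : I -> E) x : msum P v = Some x ->
  msum P (p \o v) = Some (p x) /\ msum P (q \o v) = Some (q x).
Proof.
have [pz pz' _] := cz.
rewrite (msum_split (e := p \o v) (r := q \o v)) => [|i _]; last by case: (pq (v i)).
case Ds: (msum P (p \o v)) => [s|//]; case Dt: (msum P (q \o v)) => [t|//] st.
have sz : ele s z by apply: principal_msum pz _ Ds => i _; case: (pq (v i)).
have tz : ele t (ecompl z) by apply: principal_msum pz' _ Dt => i _; case: (pq (v i)).
by have [-> ->] := central_projection_unique sz tz st.
Qed.

Definition central_part (c : bool) b : E := if c then p b else q b.

Definition central_cut (W : word E) : word E :=
  word_of (fun k : 'I_(wsize W) * bool => central_part k.2 (W k.1)).

Lemma central_cut_refines W : refines (central_cut W) W.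
Proof.
suff r : refines_along fst (fun k : 'I_(wsize W) * bool => central_part k.2 (W k.1)) W.
  exact: refines_of r.
apply: (refines_along_fst (e := fun i (c : bool) => central_part c (W i))) => i.
by rewrite msum_bool; case: (pq (W i)).
Qed.

Lemma central_cut_mono V W : refines V W -> refines (central_cut V) (central_cut W).
Proof.
move=> [f fVW]; exists (enum_rank \o (fun k => (f k.1, k.2)) \o enum_val).
apply: refines_along_comp (word_of_refines _).
apply: refines_along_comp (refines_word_of _) _.
apply: (refines_along_prod (v := fun i (c : bool) => central_part c (V i))
  (w := fun i (c : bool) => central_part c (W i))) => c i.
by have [] := central_projection_msum (fVW i); case: c.
Qed.

(** Cutting is monotone for refinement, so the cut of a common refinement in [D]
    refines any two words of [D] and their cuts. *)
Lemma central_cut_maximal D W : maximal_directed D -> D W -> D (central_cut W).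
Proof.
move=> [[Dsum dD] _ maxD] DW.
pose D' := D `|` [set central_cut V | V in D].
have cut V : D' V -> exists2 W, D W & refines (central_cut W) V.
  move=> [DV|[W' DW' <-]]; first by exists V => //; exact: central_cut_refines.
  by exists W' => //; exact: refines_refl.
apply: (maxD D' _ (fun V DV => or_introl DV)); last by right; exists W.
split=> [V [/Dsum //|[W' DW' <-]]|V1 V2 /cut[W1 D1 c1] /cut[W2 D2 c2]].
  by have [f fW] := central_cut_refines W'; rewrite (msum_refines predT fW) Dsum.
have [W3 [D3 r1 r2]] := dD _ _ D1 D2; exists (central_cut W3); split.
- by right; exists W3.
- exact: refines_trans (central_cut_mono r1) c1.
- exact: refines_trans (central_cut_mono r2) c2.
Qed.

Lemma central_projection1 : p eone = z.
Proof. by have [] := central_projection_unique (ele_refl z) (ele_refl _) (ecomplP z). Qed.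

Lemma central_subsums D : maximal_directed D -> subsums D z.
Proof.
move=> maxD; have [[Dsum _] [W DW] _] := maxD.
exists (central_cut W); split; first exact: central_cut_maximal.
exists (fun j => (enum_val j).2).
rewrite (msum_refines (fun k => k.2) (word_of_refines _)) -central_projection1.
have [<- _] := central_projection_msum (Dsum W DW).
rewrite -(msum_pair (P := predT) (Q := fun _ => id) (e := fun i (c : bool) => central_part c (W i))) //.
by move=> i _; rewrite -(msum1 (fun c : bool => central_part c (W i)) true); apply: eq_msum => // -[].
Qed.

End Projections.

Lemma central_block (hE : homogeneous E) z B : central z -> block B -> subea_set B z.
Proof.
move=> cz /(block_subsums hE)[D maxD ->].
have dec b : exists d : E * E, [/\ ele d.1 z, ele d.2 (ecompl z) & oplus d.1 d.2 = Some b].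
  by have [_ _ /(_ b)[d [dP _]]] := cz; exists d.
have [d dP] := choice dec.
exact: (central_subsums (p := fun b => (d b).1) (q := fun b => (d b).2) cz dP maxD).
Qed.

End Central.

(** * The compatibility center *)

Section CompatibilityCenter.
Variable E : effectAlgebraType.
Hypothesis hE : homogeneous E.
Local Notation K := (compatibility_center E).
Implicit Types (a b c x y z : E).

Lemma subea_ecompl_closed (B : subEffectAlgebra E) a : subea_set B a -> subea_set B (ecompl a).
Proof. by move=> Ba; exact: subea_compl Ba (ecomplP a). Qed.

(** What lies below [a] and [a'] belongs to
    every block, hence to K, where it must vanish. *)
Lemma compatibility_center_sharp (k : subea_sort K) :
  sharp_element k -> sharp_element (subea_val k).
Proof.
move=> sk x xk xk'; have Kx : subea_set K x.
  by move=> B bB; apply: block_isotropic xk xk' => //; exact: (subea_valP k B bB).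
have : subea_mk Kx = ezero; last by move=> [].
apply: sk; first exact/subea_ele.
by apply/subea_ele; rewrite subea_ecompl.
Qed.

Lemma compatibility_center_split a b : subea_set K a ->
  exists c1 c2, [/\ ele c1 a, ele c2 (ecompl a) & oplus c1 c2 = Some b].
Proof.
move=> Ka; have [B [bB Bb _]] := orthogonal_block hE (oplus_opt_r0 (Some b)).
have Ba := Ka B bB; have [/riesz_subeaP rB _] := bB.
have [c1 [c2 [_ _ c1a c2a c12]]] :=
  rB b a (ecompl a) eone Bb Ba (subea_ecompl_closed Ba) (ecomplP a) (ele1 b).
by exists c1, c2.
Qed.

(** For orthogonal [x, y <= a], a block containing [x], [y] and [a] splits [y]
    along [x' = a' (+) (a - x)]; the part below [a'] vanishes by sharpness. *)
Lemma compatibility_center_principal a : subea_set K a -> sharp_element a -> principal a.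
Proof.
move=> Ka sa x y z xa ya xy.
have [B [bB Bx By]] := orthogonal_block hE xy.
have Ba := Ka B bB; have [/riesz_subeaP rB _] := bB.
have [r xr] := xa.
have Br : subea_set B r := subea_diff Ba Bx xr.
have ar : oplus (ecompl a) r = Some (ecompl x).
  have := ecomplP a; rewrite oplusE -xr.
  rewrite oplusE -oplus_optA (oplus_optC (Some r)).
  case ar: (_ [+] Some r) => [c|//] /ecompl_unique <-; exact: ar.
have yx : ele y (ecompl x) by apply/ele_ecompl; exists z; rewrite oplus_optC.
have [y1 [y2 [_ _ y1a y2r y12]]] := rB _ _ _ _ By (subea_ecompl_closed Ba) Br ar yx.
have y10 : y1 = ezero by apply: sa => //; exact: ele_trans (ele_oplusl y12) ya.
have yr : ele y r.
  by move: y12; rewrite y10 oplusE oplus_opt0 => -[<-].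
have [s ys] := yr; exists s.
rewrite oplusE -xy oplusE.
by rewrite -oplus_optA -xr oplusE -ys.
Qed.

Lemma sharp_ecompl a : sharp_element a -> sharp_element (ecompl a).
Proof. by move=> sa x xa; rewrite ecomplK => xa'; exact: sa. Qed.

Lemma compatibility_center_central a : subea_set K a -> sharp_element a -> central a.
Proof.
move=> Ka sa; apply: principal_central => [||b].
- exact: compatibility_center_principal.
- by apply: compatibility_center_principal; [exact: subea_ecompl_closed|exact: sharp_ecompl].
- exact: compatibility_center_split.
Qed.

Lemma principal_subea (B : subEffectAlgebra E) (k : subea_sort B) :
  principal (subea_val k) -> principal k.
Proof.
move=> pk x y z /subea_ele xk /subea_ele yk /subea_oplusP xy.
by apply/subea_ele; exact: pk xk yk xy.
Qed.

(** The decomposition in E of an element of K along a central element is the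
    one which the Riesz property gives in each block, so it stays in K. *)
Lemma central_compatibility_center (k : subea_sort K) : central (subea_val k) -> central k.
Proof.
move=> [pk pk' dec]; apply: principal_central => [||b].
- exact: principal_subea.
- by apply: principal_subea; rewrite subea_ecompl.
have [[c1 c2] [/= [c1k c2k c12] u]] := dec (subea_val b).
have Kc1 : subea_set K c1.
  move=> B bB; have [/riesz_subeaP rB _] := bB.
  have Bb : subea_set B (subea_val b) := subea_valP b B bB.
  have Bk : subea_set B (subea_val k) := subea_valP k B bB.
  have [d1 [d2 [Bd1 Bd2 d1k d2k d12]]] :=
    rB _ _ _ eone Bb Bk (subea_ecompl_closed Bk) (ecomplP _) (ele1 _).
  by have [->] := u (d1, d2) (And3 d1k d2k d12).
have Kc2 : subea_set K c2 := subea_diff (subea_valP b) Kc1 c12.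
exists (subea_mk Kc1), (subea_mk Kc2); split; last exact/subea_oplusP.
  exact/subea_ele.
by apply/subea_ele; rewrite subea_ecompl.
Qed.

End CompatibilityCenter.

Theorem proposition4p7 (E : effectAlgebraType) (hE : homogeneous E) :
  let K := compatibility_center E in
  center E = (@subea_val E K) @` center (subea_sort K) /\
  (@subea_val E K) @` center (subea_sort K) =
    (@subea_val E K) @` sharp_set (subea_sort K).
Proof.
move=> K.
have EK : center E `<=` (@subea_val E K) @` center (subea_sort K).
  move=> z cz; have Kz : subea_set K z by move=> B; exact: central_block.
  by exists (subea_mk Kz) => //; exact: central_compatibility_center.
have KS : (@subea_val E K) @` center (subea_sort K) `<=` (@subea_val E K) @` sharp_set (subea_sort K).
  by move=> _ [k [pk _ _] <-]; exists k => //; exact: principal_sharp.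
have SE : (@subea_val E K) @` sharp_set (subea_sort K) `<=` center E.
  move=> _ [k sk <-]; apply: (compatibility_center_central hE (subea_valP k)).
  exact: compatibility_center_sharp.
by split; apply/seteqP; split=> //; [exact: subset_trans KS SE|exact: subset_trans SE EK].
Qed.
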